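(* Let $p\ge 5$ be a prime and let $b,c$ be integers. Set $d:=b^2-4c$ and suppose that $p\nmid d$. Then $$\sum_{k=0}^{p-1}(2k+1)(-1)^k\frac{T_k(b,c)^4}{d^{2k}}\equiv p\sum_{k=0}^{p-1}\binom{2k}{k}^2\frac{(-c)^kb^{2k}}{d^{2k}}\pmod{p^3}$$ and $$\sum_{k=0}^{p-1}(2k+1)^3(-1)^k\frac{T_k(b,c)^4}{d^{2k}}\equiv-p\sum_{k=0}^{p-1}\binom{2k}{k}^2\frac{(-c)^kb^{2(k-1)}\left(3b^2+4b^2k+8ck\right)}{d^{2k}}\pmod{p^3}.$$
   Context: For integers $b,c$ and $n\ge 0$, $T_n(b,c)$ denotes the generalized central trinomial coefficient, i.e. the coefficient of $x^n$ in the expansion of $(x^2+bx+c)^n$. Convention: $0^0=1$, and the product $b^{2(k-1)}(3b^2+4b^2k+8ck)$ is understood as $(3+4k)b^{2k}+8ck\,b^{2(k-1)}$, where the last term is $0$ for $k=0$ (so the $k=0$ value is $3$, also when $b=0$). For rational numbers $u,v$, $u\equiv v\pmod{p^m}$ means that $u-v\in p^m\mathbb{Z}_{(p)}$, where $\mathbb{Z}_{(p)}$ is the ring of rationals with denominator not divisible by $p$. *)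

(* Defs.v *)
From mathcomp Require Import all_boot all_order all_algebra.

Set Implicit Arguments.
Unset Strict Implicit.
Unset Printing Implicit Defensive.

Import GRing.Theory.
Local Open Scope ring_scope.

Definition trinom (b c : int) (n : nat) : int :=
  (('X^2 + b *: 'X + c%:P : {poly int}) ^+ n)`_n.

(* Z_(p); [denq] is the (positive) denominator in lowest terms. *)
Definition Zloc (p : nat) : {pred rat} := [pred w : rat | ~~ (p%:Z %| denq w)%Z].

Definition eqmodp (p m : nat) (u v : rat) : Prop :=
  exists2 w : rat, w \in Zloc p & u - v = p%:R ^+ m * w.

(* b^(2(k-1)) (3b^2 + 4b^2k + 8ck), with the k b^(2(k-1)) part read as 0 at
   k = 0: there the truncated exponent 2 * k.-1 is harmless because of the
   factor k. *)
Definition weight (b c : int) (k : nat) : int :=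
  (3 + 4 * k%:Z) * b ^+ (2 * k) + 8 * c * k%:Z * b ^+ (2 * k.-1).

(* Main.v *)
Require Import Defs.
From mathcomp Require Import all_boot all_order all_algebra.
From mathcomp Require Import ring zify.

Set Implicit Arguments.
Unset Strict Implicit.
Unset Printing Implicit Defensive.

Import GRing.Theory Num.Theory.
Local Open Scope ring_scope.

(** Write T_n for [trinom b c n], t = c/d, c_k = C(2k,k) and
    w(n,k) = C(n,k) C(n+k,k); then b^2/d = 1 + 4t.

    The numbers T_n are d^(n/2) P_n(b / sqrt d) for the Legendre polynomials
    P_n, and the square of P_n is a polynomial in t: Clausen's formula reads
    T_n^2 / d^n = sum_k w(n,k) c_k t^k ([trinom_sq]). Hence both sides of each
    congruence are values at t of polynomials with integer coefficients, and
    as t has no p in its denominator it is enough to compare these polynomials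
    coefficientwise modulo p^3 ([eqmodp_evq]).

    On the left, products of the w(n,k) are again integer combinations of the
    w(n,s) ([legc_mul]), and the alternating sum of (2n+1) w(n,s) over n < p
    telescopes to p C(p-1,s) C(p+s,s) ([sum_legc]). Here C(p-1,s) C(p+s,s) is
    the product of the (p^2-j^2)/j^2 for 1 <= j <= s; when s < p it is (-1)^s
    modulo p^2 ([altq_mod]). With (2n+1)^3 in place of 2n+1 there is an extra factor
    4p^2-4s-3 ([sum_legc_cube]). What is left is a sum over s that is an
    iterated difference of a binomial coefficient ([alt_sum_bin_lin]). So for
    m < p the coefficient of t^m is, modulo p^3, equal to p (-1)^m times the
    sum of C(m,i) c_i c_j over i+j = m, with each term multiplied by
    -(3+4m+4ij) in the cubic case.

    On the right, the coefficient of t^m is p times a sum of c_k^2 [t^m] z^k,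
    where z = -t(1+4t), with each term multiplied by -(3+2k+2m) in the cubic
    case. For m < p the two sides then agree exactly, by the identities
      (-1)^m sum_(i+j=m) C(m,i) c_i c_j = sum_k c_k^2 [t^m] z^k,
      (-1)^m sum_(i+j=m) C(m,i) c_i c_j (m+2ij) = sum_k k c_k^2 [t^m] z^k.
    They are proved together: the two left-hand sides and the two right-hand
    sides satisfy the same system of recurrences of order one in m
    ([zsum_conv]).

    For m >= p both coefficients vanish modulo p^3. On the left only pairs
    i, j < p with i+j = m matter, and then p divides C(m,i) and also one of
    c_i and c_j; on the right only k < p with 2k >= m matter, and then p
    divides c_k. *)

(** * Binomial coefficients as integers *)

(** Proves an equation by exhibiting it as a multiple of a known one: the side
    condition is a polynomial identity, left to [ring]. *)
Lemma eq_lincomb (R : comPzRingType) (a b x y k : R) :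
  a = b -> x - y = k * (a - b) -> x = y.
Proof. by move=> -> /eqP; rewrite subrr mulr0 subr_eq0 => /eqP. Qed.

Arguments eq_lincomb {R a b x y} k.

Lemma binZ_left n k : k.+1%:Z * 'C(n, k.+1)%:Z = (n%:Z - k%:Z) * 'C(n, k)%:Z.
Proof.
rewrite -PoszM mul_bin_left.
case: (leqP k n) => [le|lt]; first by rewrite PoszM -subzn.
by rewrite bin_small // muln0 mulr0.
Qed.

Lemma binZ_diag n k : k.+1%:Z * 'C(n.+1, k.+1)%:Z = n.+1%:Z * 'C(n, k)%:Z.
Proof. by rewrite -!PoszM mul_bin_diag. Qed.

Lemma binZ_down n k : n.+1%:Z * 'C(n, k)%:Z = (n.+1%:Z - k%:Z) * 'C(n.+1, k)%:Z.
Proof.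
rewrite -PoszM -[n in X in (_ * X)%N]/(n.+1.-1) mul_bin_down.
case: (leqP k n.+1) => [le|lt]; first by rewrite PoszM -subzn.
by rewrite bin_small // muln0 mulr0.
Qed.

Definition cbin (k : nat) : int := 'C(2 * k, k)%:Z.

Lemma cbinS k : (k.+1)%:Z * cbin k.+1 = 2 * (2 * k%:Z + 1) * cbin k.
Proof.
rewrite /cbin (_ : 2 * k.+1 = (2 * k).+2)%N; last by lia.
rewrite binZ_diag -bin_sub; last by lia.
have -> : ((2 * k).+1 - k = k.+1)%N by lia.
have -> : (2 * k).+2%:Z = 2 * k.+1%:Z by lia.
rewrite -mulrA binZ_diag mulrA; congr (_ * _ * _); lia.
Qed.

(** The left-hand side is, up to sign, the i-th finite difference at j of the
    function C(-,i+a), and each difference lowers the index by one. *)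
Lemma alt_sum_bin (i a j : nat) :
  \sum_(r < i.+1) (-1) ^+ r * 'C(i, r)%:Z * 'C(j + r, i + a)%:Z
  = (-1) ^+ i * 'C(j, a)%:Z :> int.
Proof.
elim: i a j => [|i IH] a j.
  by rewrite big_ord1 bin0 addn0 add0n !mul1r.
rewrite big_ord_recl /= bin0 addn0 expr0 !mul1r.
under eq_bigr => r _ do rewrite /bump add1n binS PoszD mulrDr mulrDl.
rewrite big_split /= addrA.
rewrite (_ : \sum_(r < i.+1) (-1) ^+ r.+1 * 'C(i, r)%:Z * _ =
  - \sum_(r < i.+1) (-1) ^+ r * 'C(i, r)%:Z
      * 'C(j.+1 + r, i + a.+1)%:Z); last first.
  rewrite -sumrN; apply: eq_bigr => r _.
  by rewrite exprS addnS addSn addnS addSn; ring.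
rewrite IH.
have -> : 'C(j, i.+1 + a)%:Z
   + \sum_(r < i.+1) (-1) ^+ r.+1 * 'C(i, r.+1)%:Z * 'C(j + r.+1, i.+1 + a)%:Z
   = \sum_(r < i.+1) (-1) ^+ r * 'C(i, r)%:Z * 'C(j + r, i + a.+1)%:Z.
  transitivity (\sum_(r < i.+2) (-1) ^+ r * 'C(i, r)%:Z * 'C(j + r, i + a.+1)%:Z).
    by rewrite [RHS]big_ord_recl /= bin0 addn0 expr0 !mul1r addnS addSn.
  by rewrite big_ord_recr /= bin_small // mulr0 mul0r addr0.
rewrite IH binS PoszD exprS; ring.
Qed.

(** By s C(s,i) = (i+1) C(s,i+1) + i C(s,i) with s = j + r, this combines the
    cases a = 0 and a = 1 of [alt_sum_bin]. *)
Lemma alt_sum_bin_lin (i j : nat) (u v : int) :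
  \sum_(r < i.+1) (-1) ^+ r * 'C(i, r)%:Z * 'C(j + r, i)%:Z
      * (u + v * (j + r)%N%:Z)
  = (-1) ^+ i * (u + v * (i%:Z + j%:Z + i%:Z * j%:Z)) :> int.
Proof.
have e0 := alt_sum_bin i 0 j; have e1 := alt_sum_bin i 1 j.
rewrite bin0 addn0 in e0; rewrite bin1 addn1 in e1.
transitivity ((u + v * i%:Z) *
     (\sum_(r < i.+1) (-1) ^+ r * 'C(i, r)%:Z * 'C(j + r, i)%:Z)
   + v * i.+1%:Z *
     \sum_(r < i.+1) (-1) ^+ r * 'C(i, r)%:Z * 'C(j + r, i.+1)%:Z).
  rewrite !mulr_sumr -big_split /=; apply: eq_bigr => r _.
  apply: (eq_lincomb (- v * (-1) ^+ r * 'C(i, r)%:Z) (binZ_left (j + r) i)).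
  ring.
rewrite e0 e1; have -> : i.+1%:Z = i%:Z + 1 by lia.
ring.
Qed.

(** * Coefficients of Legendre polynomials *)

(** The Legendre polynomial P_n(1 + 2x) is the sum of the [legc n k] x^k. As a
    function of n, [legc n k] is a polynomial of degree k in n(n+1). *)
Definition legc (n k : nat) : int := 'C(n, k)%:Z * 'C(n + k, k)%:Z.

Lemma legc_stepk n k :
  k.+1%:Z ^+ 2 * legc n k.+1 = (n%:Z - k%:Z) * (n%:Z + k%:Z + 1) * legc n k.
Proof.
rewrite /legc addnS; have h1 := binZ_left n k; have h2 := binZ_diag (n + k) k.
transitivity ((k.+1%:Z * 'C(n, k.+1)%:Z)
  * (k.+1%:Z * 'C((n + k).+1, k.+1)%:Z)); first ring.
rewrite h1 h2; have -> : (n + k).+1%:Z = n%:Z + k%:Z + 1 by lia.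
ring.
Qed.

Lemma legc_stepn n k :
  (n.+1%:Z - k%:Z) * legc n.+1 k = (n%:Z + k%:Z + 1) * legc n k.
Proof.
rewrite /legc; have h1 := binZ_down n k; have h2 := binZ_down (n + k) k.
have e : (n + k).+1%:Z = n%:Z + k%:Z + 1 by lia.
rewrite e in h2; rewrite addSn mulrA -h1.
have -> : (n%:Z + k%:Z + 1) * ('C(n, k)%:Z * 'C(n + k, k)%:Z) =
  'C(n, k)%:Z * ((n%:Z + k%:Z + 1) * 'C(n + k, k)%:Z) by ring.
rewrite h2; have -> : n.+1%:Z = n%:Z + 1 by lia.
ring.
Qed.

(** As polynomials in n(n+1), the [legc n s] form a basis in which multiplying
    by n(n+1) - i(i+1) only involves s and s + 1; since by [legc_stepk] that
    factor leads from [legc n i] to [legc n i.+1], the structure constants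
    follow by induction on i. The sum starts at s = j + 0 so that no truncated
    difference occurs in a binomial coefficient. *)
Lemma legc_mul n i j :
  legc n i * legc n j = 'C(i + j, i)%:Z *
     \sum_(r < i.+1) 'C(i, r)%:Z * 'C(j + r, i)%:Z * legc n (j + r)%N.
Proof.
elim: i => [|i IH].
  by rewrite big_ord1 !bin0 addn0 /legc !bin0 !mul1r.
have nz : i.+1%:Z ^+ 2 != 0 :> int by [].
apply: (mulfI nz).
rewrite [_ * (legc n i.+1 * _)]mulrA legc_stepk -[_ * legc n i * _]mulrA IH.
have hC : i.+1%:Z * 'C(i.+1 + j, i.+1)%:Z = (i%:Z + j%:Z + 1) * 'C(i + j, i)%:Z.
  rewrite addSn binZ_diag; congr (_ * _); lia.
have -> : i.+1%:Z ^+ 2 * ('C(i.+1 + j, i.+1)%:Z *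
      \sum_(r < i.+2) 'C(i.+1, r)%:Z * 'C(j + r, i.+1)%:Z * legc n (j + r))
  = 'C(i + j, i)%:Z * \sum_(r < i.+2) (i%:Z + j%:Z + 1) * 'C(i.+1, r)%:Z
      * (i.+1%:Z * 'C(j + r, i.+1)%:Z) * legc n (j + r).
  rewrite !mulr_sumr; apply: eq_bigr => r _.
  apply: (eq_lincomb (i.+1%:Z * 'C(i.+1, r)%:Z * 'C(j + r, i.+1)%:Z
    * legc n (j + r)) hC); ring.
rewrite mulrCA; congr (_ * _).
(* With s = j + r and N = n(n+1), the factor N - i(i+1) contributed by
   legc_stepk splits as (s(s+1) - i(i+1)) + (N - s(s+1)): the first part gives
   X r and the second, by legc_stepk again, gives Y r, in which s becomes
   s + 1. *)
pose X r := 'C(i, r)%:Z * (i.+1%:Z * 'C(j + r, i.+1)%:Z)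
  * (j%:Z + r%:Z + i%:Z + 1) * legc n (j + r).
pose Y r := 'C(i, r)%:Z * 'C(j + r, i)%:Z * (j + r).+1%:Z ^+ 2
  * legc n (j + r).+1.
transitivity (\sum_(r < i.+1) X r + \sum_(r < i.+1) Y r).
  rewrite mulr_sumr -big_split /=; apply: eq_bigr => r _.
  rewrite /X /Y -[_ * _ * (j + r).+1%:Z ^+ 2 * _]mulrA legc_stepk binZ_left.
  rewrite PoszD; ring.
rewrite [RHS]big_ord_recl /= addn0.
have -> : \sum_(r < i.+1) X r = X 0%N + \sum_(r < i.+1) X r.+1.
  transitivity (\sum_(r < i.+2) X r); last by rewrite big_ord_recl.
  by rewrite [RHS]big_ord_recr /= /X bin_small ?mul0r ?addr0.
rewrite -addrA -big_split /=; congr (_ + _).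
  rewrite /X addn0 !bin0; ring.
apply: eq_bigr => r _; rewrite /X /Y /bump add1n addnS.
rewrite [binomial i.+1 _]binS PoszD.
rewrite [_ * 'C((j + r).+1, _)%:Z]binZ_diag.
have e1 : r.+1%:Z = r%:Z + 1 by lia.
have e2 : (j + r).+1%:Z = j%:Z + r%:Z + 1 by lia.
have h1 := binZ_left i r; rewrite e1 in h1; rewrite e1 e2.
apply: (eq_lincomb ((j%:Z + r%:Z + 1) * 'C(j + r, i)%:Z
  * legc n (j + r).+1) h1); ring.
Qed.

Lemma legc_small n k : (n < k)%N -> legc n k = 0.
Proof. by move=> nk; rewrite /legc bin_small // mul0r. Qed.

Lemma legc_diag n : legc n n = cbin n.
Proof. by rewrite /legc /cbin binn mul1r addnn mul2n. Qed.

(** A telescoping sum: by [legc_stepn], both (N+1-s) legc (N+1) s and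
    (N-s) legc N s are multiples of legc N s, and they add up to
    (2N+1) legc N s. *)
Lemma sum_legc N s :
  \sum_(n < N) (-1) ^+ n * (2 * n + 1)%N%:Z * legc n s
  = (-1) ^+ N * (s%:Z - N%:Z) * legc N s.
Proof.
elim: N => [|N IH].
  rewrite big_ord0 subr0 mul1r; case: s => [|s]; first by rewrite mul0r.
  by rewrite legc_small // mulr0.
rewrite big_ord_recr /= IH.
apply: (eq_lincomb (- (-1) ^+ N) (legc_stepn N s)).
have -> : (2 * N + 1)%N%:Z = 2 * N%:Z + 1 by lia.
have -> : N.+1%:Z = N%:Z + 1 by lia.
rewrite [(-1) ^+ N.+1]exprS; ring.
Qed.

Lemma sum_legc_cube N s :
  \sum_(n < N) (-1) ^+ n * (2 * n + 1)%N%:Z ^+ 3 * legc n s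
  = (-1) ^+ N * (s%:Z - N%:Z) * legc N s * (4 * N%:Z ^+ 2 - 4 * s%:Z - 3).
Proof.
elim: N => [|N IH].
  rewrite big_ord0 subr0 mul1r; case: s => [|s]; first by rewrite !mul0r.
  by rewrite legc_small // mulr0 mul0r.
rewrite big_ord_recr /= IH.
apply: (eq_lincomb (- (-1) ^+ N * (4 * N.+1%:Z ^+ 2 - 4 * s%:Z - 3))
  (legc_stepn N s)).
have -> : (2 * N + 1)%N%:Z = 2 * N%:Z + 1 by lia.
have -> : N.+1%:Z = N%:Z + 1 by lia.
rewrite [(-1) ^+ N.+1]exprS; ring.
Qed.

(** The product of (p^2 - j^2) / j^2 over 1 <= j <= s. For odd p, it is the
    quotient by p of the alternating sum of (2n+1) legc n s over n < p. *)
Definition altq (p s : nat) : int := 'C(p.-1, s)%:Z * 'C(p + s, s)%:Z.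

Lemma altqE p s : (0 < p)%N -> (p%:Z - s%:Z) * legc p s = p%:Z * altq p s.
Proof.
case: p => // p _; rewrite /legc /altq /= !mulrA; congr (_ * _).
by rewrite binZ_down.
Qed.

Lemma altq_rec p s : (0 < p)%N ->
  s.+1%:Z ^+ 2 * altq p s.+1 = (p%:Z ^+ 2 - s.+1%:Z ^+ 2) * altq p s.
Proof.
case: p => // p _; rewrite /altq /= addnS.
transitivity ((s.+1%:Z * 'C(p, s.+1)%:Z)
  * (s.+1%:Z * 'C((p.+1 + s).+1, s.+1)%:Z)).
  ring.
rewrite binZ_left binZ_diag.
have -> : (p.+1 + s).+1%:Z = p%:Z + s%:Z + 2 by lia.
have -> : p.+1%:Z = p%:Z + 1 by lia.
have -> : s.+1%:Z = s%:Z + 1 by lia.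
ring.
Qed.

Lemma coprimez_prime p s : prime p -> (0 < s < p)%N -> coprimez p%:Z s%:Z.
Proof.
move=> pp /andP[s0 sp]; rewrite coprimezE !absz_nat.
by rewrite prime_coprime // gtnNdvd.
Qed.

(** Each factor (p^2 - j^2) / j^2 of [altq p s] is -1 modulo p^2; the
    recurrence says this without division. *)
Lemma altq_mod p s : prime p -> (s < p)%N ->
  (p%:Z ^+ 2 %| altq p s - (-1) ^+ s)%Z.
Proof.
move=> pp; have p0 := prime_gt0 pp; elim: s => [|s IH] sp.
  by rewrite /altq !bin0 mulr1 subrr dvdz0.
have /IH{IH}IH : (s < p)%N by exact: ltnW.
rewrite -(@Gauss_dvdzr _ (s.+1%:Z ^+ 2)); last first.
  by rewrite coprimezXl // coprimezXr // coprimez_prime.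
have -> : s.+1%:Z ^+ 2 * (altq p s.+1 - (-1) ^+ s.+1) =
   p%:Z ^+ 2 * altq p s - s.+1%:Z ^+ 2 * (altq p s - (-1) ^+ s).
  rewrite mulrBr altq_rec // [(-1) ^+ s.+1]exprS; ring.
by apply: rpredB; [apply: dvdz_mulr; exact: dvdzz | exact: dvdz_mull].
Qed.

(** * Squares of trinomial coefficients *)

Section Trinom.
Variables b c : int.
Let Q : {poly int} := 'X^2 + b *: 'X + c%:P.

(** An auxiliary sequence that turns the three-term recurrence of the
    trinomial coefficients into two recurrences of order one. *)
Definition trinom_next n : int := (Q ^+ n)`_n.+1.

Lemma coef_der n k : k.+1%:Z * (Q ^+ n.+1)`_k.+1
  = n.+1%:Z * ((2 * 'X + b%:P) * Q ^+ n)`_k.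
Proof.
have e : (Q ^+ n.+1)^`() = n.+1%:Z *: ((2 * 'X + b%:P) * Q ^+ n).
  rewrite deriv_exp /= /Q !derivD derivXn derivZ derivX derivC addr0.
  rewrite -[n.+1%:Z]natz scaler_nat -mul_polyC mulr1 expr1; congr (_ *+ _).
  ring.
by rewrite -[RHS]coefZ -e coef_deriv -[k.+1%:Z]natz mulr_natl.
Qed.

Lemma coef_der_mul (P : {poly int}) k :
  ((2 * 'X + b%:P) * P)`_k.+1 = 2 * P`_k + b * P`_k.+1.
Proof.
by rewrite mulrDl coefD -mulrA coefCM -polyC_natr coefCM coefXM.
Qed.

Lemma coefQ (P : {poly int}) k :
  (Q * P)`_k.+2 = P`_k + b * P`_k.+1 + c * P`_k.+2.
Proof.
by rewrite /Q !mulrDl !coefD coefXnM /= subn2 -mul_polyC -mulrA !coefCM coefXM.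
Qed.

Lemma trinom0 : trinom b c 0 = 1.
Proof. by rewrite /trinom expr0 coef1. Qed.

Lemma trinom1 : trinom b c 1 = b.
Proof.
by rewrite /trinom expr1 !coefD coefXn coefZ coefX coefC mulr1 addr0 add0r.
Qed.

(** The coefficient of X^(n-1) in Q^n is c times that of X^(n+1), which gives
    the coefficient 2c. *)
Lemma trinom_step n : trinom b c n.+1 = b * trinom b c n + 2 * c * trinom_next n.
Proof.
case: n => [|n].
  by rewrite trinom0 trinom1 /trinom_next expr0 coef1 mulr0 addr0 mulr1.
(* Two expressions of the coefficient of X^(n+2) in Q^(n+2): from its
   derivative, and from Q * Q^(n+1). Comparing them eliminates the
   coefficient of X^n in Q^(n+1). *)
have e1 : trinom b c n.+2 = 2 * (Q ^+ n.+1)`_n + b * trinom b c n.+1.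
  apply: (@mulfI _ n.+2%:Z) => //.
  by rewrite /trinom -/Q coef_der coef_der_mul.
have e2 : trinom b c n.+2 =
    (Q ^+ n.+1)`_n + b * trinom b c n.+1 + c * trinom_next n.+1.
  by rewrite /trinom -/Q [Q ^+ n.+2]exprS coefQ.
rewrite e1 in e2 *; lia.
Qed.

Lemma trinom_next_step n :
  n.+2%:Z * trinom_next n.+1 = n.+1%:Z * (2 * trinom b c n + b * trinom_next n).
Proof. by rewrite /trinom_next coef_der coef_der_mul. Qed.

Lemma trinom_rec n :
  n.+2%:Z * trinom b c n.+2 =
  (2 * n + 3)%N%:Z * b * trinom b c n.+1
  - n.+1%:Z * (b ^+ 2 - 4 * c) * trinom b c n.
Proof.
have h1 := trinom_step n; have h2 := trinom_next_step n.
rewrite (trinom_step n.+1).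
apply: (eq_lincomb (2 * c) h2).
rewrite h1.
have -> : n.+2%:Z = n%:Z + 2 by lia.
have -> : n.+1%:Z = n%:Z + 1 by lia.
have -> : (2 * n + 3)%N%:Z = 2 * n%:Z + 3 by lia.
ring.
Qed.
End Trinom.

(** The value of [sqpol n] at c/d is T_n^2 / d^n for T_n = trinom b c n. As
    T_n satisfies a three-term recurrence, a recurrence for its square also
    involves the products of consecutive terms: [crosspol n] is the polynomial
    with n T_n T_(n-1) = b d^(n-1) times its value at c/d. *)
Definition sqpol (n : nat) : {poly int} := \poly_(k < n.+1) (legc n k * cbin k).
Definition crosspol (n : nat) : {poly int} :=
  \poly_(k < n.+1) ((n%:Z - k%:Z) * legc n k * cbin k).

Lemma coef_sqpol n k : (sqpol n)`_k = legc n k * cbin k.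
Proof.
by rewrite coef_poly; case: ltnP => // nk; rewrite legc_small // mul0r.
Qed.

Lemma coef_crosspol n k : (crosspol n)`_k = (n%:Z - k%:Z) * legc n k * cbin k.
Proof.
by rewrite coef_poly; case: ltnP => // nk; rewrite legc_small // mulr0 mul0r.
Qed.

Lemma crosspol_rec n : crosspol n.+1 + crosspol n = (2 * n + 1)%N%:Z *: sqpol n.
Proof.
apply/polyP => k; rewrite coefD coefZ !coef_crosspol coef_sqpol legc_stepn.
have -> : (2 * n + 1)%N%:Z = 2 * n%:Z + 1 by lia.
ring.
Qed.

(** The coefficient form of [sqpol_rec] divided by the central binomial c_(k+1):
    the term 2 (k+1) comes from 4 (2k+1) c_k = 2 (k+1) c_(k+1). *)
Lemma legc_rec3 n k :
  n.+2%:Z ^+ 2 * legc n.+2 k.+1 =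
  (2 * n + 3)%N%:Z
    * ((2 * k + 3)%N%:Z * legc n.+1 k.+1 + 2 * k.+1%:Z * legc n.+1 k)
  + n.+1%:Z ^+ 2 * legc n k.+1.
Proof.
(* For k = n + 1 the factor n + 1 - k, by which legc_stepk and legc_stepn
   would have to be divided, vanishes; there the identity is cbinS. *)
have [->|kn] := eqVneq k n.+1.
  rewrite (legc_small (n := n)) // mulr0 addr0 (legc_small (n := n.+1)) //.
  rewrite !legc_diag.
  apply: (eq_lincomb n.+2%:Z (cbinS n.+1)).
  have -> : n.+2%:Z = n%:Z + 2 by lia.
  have -> : n.+1%:Z = n%:Z + 1 by lia.
  have -> : (2 * n + 3)%N%:Z = 2 * n%:Z + 3 by lia.
  ring.
have nz : k.+1%:Z * (n.+1%:Z - k%:Z) * (n.+1%:Z + k%:Z + 1) != 0.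
  rewrite !mulf_neq0 //; lia.
apply: (mulfI nz).
have h1 := legc_stepk n.+1 k; have h2 := legc_stepn n.+1 k.+1.
have h3 := legc_stepn n k.+1.
have e1 : n.+2%:Z = n%:Z + 2 by lia.
have e2 : n.+1%:Z = n%:Z + 1 by lia.
have e3 : k.+1%:Z = k%:Z + 1 by lia.
have -> : (2 * n + 3)%N%:Z = 2 * n%:Z + 3 by lia.
have -> : (2 * k + 3)%N%:Z = 2 * k%:Z + 3 by lia.
rewrite !(e1, e2, e3) in h1 h2 h3 *.
apply: (eq_lincomb ((k%:Z + 1) * (n%:Z + 1 + k%:Z + 1) * (n%:Z + 2) ^+ 2) h2).
apply/eqP; rewrite -subr_eq0; apply/eqP.
apply: (eq_lincomb ((2 * n%:Z + 3) * 2 * (k%:Z + 1) ^+ 2) h1).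
rewrite subr0.
apply/eqP; rewrite -subr_eq0; apply/eqP.
apply: (eq_lincomb ((k%:Z + 1) * (n%:Z + 1 - k%:Z) * (n%:Z + 1) ^+ 2) h3).
ring.
Qed.

Lemma sqpol_rec n :
  n.+2%:Z ^+ 2 *: sqpol n.+2 =
  (1 + 4%:P * 'X) * ((2 * n + 3)%N%:Z ^+ 2 *: sqpol n.+1
    - (2 * (2 * n + 3)%N%:Z) *: crosspol n.+1) + n.+1%:Z ^+ 2 *: sqpol n.
Proof.
apply/polyP => k; rewrite coefD mulrDl mul1r coefD -mulrA coefCM coefXM.
have e1 : n.+2%:Z = n%:Z + 2 by lia.
have e2 : n.+1%:Z = n%:Z + 1 by lia.
have e4 : (2 * n + 3)%N%:Z = 2 * n%:Z + 3 by lia.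
case: k => [|k]; rewrite /= !(coefB, coefZ, coef_sqpol, coef_crosspol).
  by rewrite /legc /cbin !bin0 e4 e1 e2; ring.
apply: (eq_lincomb (cbin k.+1) (legc_rec3 n k)).
apply/eqP; rewrite -subr_eq0; apply/eqP.
apply: (eq_lincomb (2 * (2 * n + 3)%N%:Z * legc n.+1 k) (cbinS k)).
have e3 : k.+1%:Z = k%:Z + 1 by lia.
have -> : (2 * k + 3)%N%:Z = 2 * k%:Z + 3 by lia.
rewrite e1 e2 e3 e4; ring.
Qed.

(** * Binomial convolutions of central binomial coefficients *)

(** The product of exponential generating functions: bconv f g m / m! is the
    coefficient of x^m in the product of those of f and g. The next lemmas are
    the Leibniz rule for d/dx and the multiplication by x. *)
Definition bconv (f g : nat -> int) (m : nat) : int :=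
  \sum_(i < m.+1) 'C(m, i)%:Z * f i * g (m - i)%N.

Lemma bconvC f g m : bconv f g m = bconv g f m.
Proof.
rewrite /bconv (reindex_inj rev_ord_inj) /=; apply: eq_bigr => i _.
have im := ltn_ord i; rewrite subSS subKn ?bin_sub //; ring.
Qed.

Lemma bconvS f g m :
  bconv f g m.+1 = bconv (f \o succn) g m + bconv f (g \o succn) m.
Proof.
rewrite /bconv big_ord_recl /=.
under eq_bigr => i _ do rewrite /bump add1n binS PoszD !mulrDl subSS.
rewrite big_split /= addrA addrC; congr (_ + _).
transitivity (\sum_(i < m.+2) 'C(m, i)%:Z * f i * g (m.+1 - i)%N).
  by rewrite [RHS]big_ord_recl !bin0 subn0.
rewrite big_ord_recr /= bin_small // !mul0r addr0.
by apply: eq_bigr => i _; rewrite subSn // -ltnS.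
Qed.

Lemma bconv_mull f g m :
  bconv (fun i => i%:Z * f i) g m.+1 = (m.+1)%:Z * bconv (f \o succn) g m.
Proof.
rewrite /bconv big_ord_recl /= mul0r mulr0 mul0r add0r mulr_sumr.
apply: eq_bigr => i _; rewrite /bump add1n subSS.
apply: (eq_lincomb (f i.+1 * g (m - i)%N) (binZ_diag m i)); ring.
Qed.

Definition conv_cbin m := bconv cbin cbin m.
Definition conv_kcbin m :=
  bconv (fun i => i%:Z * cbin i) (fun i => i%:Z * cbin i) m.

(** Leibniz rule, with (i+1) c_(i+1) = (4i+2) c_i in both factors. *)
Lemma conv_kcbinS m : conv_kcbin m.+1 = 2 * m%:Z * conv_cbin m + 8 * conv_kcbin m.
Proof.
rewrite /conv_kcbin /conv_cbin bconvS /bconv -big_split /=.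
rewrite !mulr_sumr -big_split /=.
apply: eq_bigr => i _; have im : (i <= m)%N by rewrite -ltnS.
rewrite !cbinS.
have -> : m%:Z = i%:Z + (m - i)%N%:Z by lia.
ring.
Qed.

Lemma conv_cbinS m :
  (m.+1)%:Z ^+ 2 * conv_cbin m.+1
  = 4 * (m.+1)%:Z ^+ 2 * conv_cbin m + 2 * conv_kcbin m.+1.
Proof.
pose f i := i%:Z * cbin i.
(* m + 1 = i + j, and the cross term of (i+j)^2 is what conv_kcbin counts. *)
have e1 : bconv (fun i => i%:Z * f i) cbin m.+1
          + bconv cbin (fun i => i%:Z * f i) m.+1
          = 4 * (m.+1)%:Z ^+ 2 * conv_cbin m.
  rewrite [bconv cbin _ _]bconvC !bconv_mull [bconv _ _ m in X in _ + X]bconvC.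
  rewrite /conv_cbin /bconv -mulrDr -big_split /= !mulr_sumr.
  apply: eq_bigr => i _.
  have im : (i <= m)%N by rewrite -ltnS.
  rewrite /f !cbinS.
  have -> : m.+1%:Z = i%:Z + (m - i)%N%:Z + 1 by lia.
  ring.
rewrite -e1 /conv_cbin /conv_kcbin /bconv mulr_sumr mulr_sumr -!big_split /=.
apply: eq_bigr => i _; have im : (i <= m.+1)%N by rewrite -ltnS.
rewrite /f.
have -> : m.+1%:Z = i%:Z + (m.+1 - i)%N%:Z by lia.
ring.
Qed.

(** * Powers of the polynomial -X(1 + 4X) *)

(** Its value at t = c/d is -c b^2 / d^2, because b^2/d = 1 + 4t. *)
Definition zpol : {poly int} := - ('X * (1 + 4%:P * 'X)).

Lemma coef_Xderiv (P : {poly int}) m : ('X * P^`())`_m = m%:Z * P`_m.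
Proof.
rewrite coefXM; case: m => [|m] /=; first by rewrite mul0r.
by rewrite coef_deriv -[m.+1%:Z]natz mulr_natl.
Qed.

Lemma coef_1aX (a : int) (P : {poly int}) m :
  ((1 + a%:P * 'X) * P)`_m.+1 = P`_m.+1 + a * P`_m.
Proof. by rewrite mulrDl mul1r coefD -mulrA coefCM coefXM. Qed.

Lemma deriv_zpol : zpol^`() = - (1 + 8%:P * 'X).
Proof.
rewrite /zpol derivN derivM derivX derivD derivM derivX !derivC.
rewrite -(_ : 4%:P * 2 = 8%:P :> {poly int}); last first.
  by rewrite -polyC_natr -polyCM.
ring.
Qed.

(** The operator X d/dX applied to a power of z = -X(1+4X): the logarithmic
    derivative of z is (1+8X) / (X(1+4X)), cleared here of its denominator. *)
Lemma theta_zpol k :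
  (1 + 4%:P * 'X) * ('X * (zpol ^+ k)^`())
  = k%:Z%:P * ((1 + 8%:P * 'X) * zpol ^+ k).
Proof.
case: k => [|k]; first by rewrite expr0 derivC !mulr0 mul0r.
rewrite deriv_exp /= deriv_zpol -[in LHS]mulr_natl.
rewrite (_ : k.+1%:Z%:P = k.+1%:R); last by rewrite -polyC_natr natz.
rewrite exprS {2}/zpol.
ring.
Qed.

(** The same derivative in another form, using (1+8X)^2 = 1 - 16z. *)
Lemma theta2_zpol k :
  (1 + 8%:P * 'X) * ('X * (zpol ^+ k.+1)^`()) =
  k.+1%:Z%:P * 'X * (16%:P * zpol ^+ k.+1 - zpol ^+ k).
Proof.
rewrite deriv_exp /= deriv_zpol -[in LHS]mulr_natl.
rewrite (_ : k.+1%:Z%:P = k.+1%:R); last by rewrite -polyC_natr natz.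
rewrite exprS {2}/zpol.
have -> : 8%:P = 2 * 4%:P :> {poly int} by rewrite -polyC_natr -polyCM.
have -> : 16%:P = 4 * 4%:P :> {poly int} by rewrite -polyC_natr -polyCM.
have e : 4%:P = 4 :> {poly int} by rewrite polyC_natr.
rewrite e; ring.
Qed.

Definition zcoef m k : int := (zpol ^+ k)`_m.

Lemma zcoef_rec1 m k :
  m.+1%:Z * zcoef m.+1 k + 4 * m%:Z * zcoef m k
  = k%:Z * (zcoef m.+1 k + 8 * zcoef m k).
Proof.
have := congr1 (fun P : {poly int} => P`_m.+1) (theta_zpol k).
by rewrite /= coefCM !coef_1aX !coef_Xderiv mulrA.
Qed.

Lemma zcoef_rec2 m k :
  m.+1%:Z * zcoef m.+1 k.+1 + 8 * m%:Z * zcoef m k.+1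
  = k.+1%:Z * (16 * zcoef m k.+1 - zcoef m k).
Proof.
have := congr1 (fun P : {poly int} => P`_m.+1) (theta2_zpol k).
by rewrite /= -!mulrA coefCM coefXM !coef_1aX !coef_Xderiv /= coefB coefCM mulrA.
Qed.

Lemma zcoef_lo m k : (m < k)%N -> zcoef m k = 0.
Proof. by move=> mk; rewrite /zcoef /zpol -mulrN exprMn coefXnM mk. Qed.

Lemma size_zpol : (size zpol <= 3)%N.
Proof.
rewrite size_polyN mulrC (leq_trans (size_polyMleq _ _)) // size_polyX addn2 /=.
rewrite ltnS (leq_trans (size_polyD _ _)) // size_poly1 geq_max /=.
by rewrite (leq_trans (size_polyMleq _ _)) // size_polyX addn2 /= size_polyC.
Qed.

Lemma zcoef_hi m k : (2 * k < m)%N -> zcoef m k = 0.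
Proof.
move=> km; apply: nth_default; apply: leq_trans (size_poly_exp_leq _ _) _.
apply: leq_trans km; rewrite ltnS leq_mul2r; apply/orP; right.
by case: (size zpol) size_zpol.
Qed.

Definition zsum N m := \sum_(k < N) cbin k ^+ 2 * zcoef m k.
Definition zsumk N m := \sum_(k < N) cbin k ^+ 2 * (k%:Z * zcoef m k).

Lemma zsum_rec N m :
  m.+1%:Z * zsum N m.+1 + 4 * m%:Z * zsum N m = zsumk N m.+1 + 8 * zsumk N m.
Proof.
rewrite !mulr_sumr -!big_split; apply: eq_bigr => k _ /=.
apply: (eq_lincomb (cbin k ^+ 2) (zcoef_rec1 m k)); ring.
Qed.

(** The generating function of the squares of the central binomials satisfies a
    second order differential equation, which here is a telescoping in k: the
    terms cancel up to a multiple of the coefficient of X^m in z^(N-1), and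
    this is zero since X^(N-1) divides z^(N-1). *)
Lemma zsumk_rec N m : (m.+1 < N)%N ->
  m.+1%:Z * zsumk N m.+1 = - (8 * m.+2%:Z) * zsumk N m - 4 * zsum N m.
Proof.
move=> mN; have tele n : \sum_(k < n.+1) cbin k ^+ 2 *
   (m.+1%:Z * (k%:Z * zcoef m.+1 k) + 8 * m.+2%:Z * (k%:Z * zcoef m k)
    + 4 * zcoef m k)
   = n.+1%:Z ^+ 2 * cbin n.+1 ^+ 2 * zcoef m n.
  elim: n => [|n IH].
    by rewrite big_ord1 (_ : cbin 1 = 2) // (_ : cbin 0 = 1) //=; ring.
  rewrite big_ord_recr /= IH.
  apply: (eq_lincomb (cbin n.+1 ^+ 2 * n.+1%:Z) (zcoef_rec2 m n)).
  apply/eqP; rewrite -subr_eq0; apply/eqP.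
  apply: (eq_lincomb (- zcoef m n.+1 * (n.+2%:Z * cbin n.+2
    + 2 * (2 * n.+1%:Z + 1) * cbin n.+1)) (cbinS n.+1)).
  have -> : m.+2%:Z = m%:Z + 2 by lia.
  have -> : m.+1%:Z = m%:Z + 1 by lia.
  have -> : n.+2%:Z = n%:Z + 2 by lia.
  have -> : n.+1%:Z = n%:Z + 1 by lia.
  ring.
case: N mN => // N mN; have := tele N; rewrite zcoef_lo // mulr0 => e0.
have e1 : m.+1%:Z * zsumk N.+1 m.+1 + 8 * m.+2%:Z * zsumk N.+1 m
    + 4 * zsum N.+1 m = 0.
  rewrite -e0 /zsumk /zsum !mulr_sumr -!big_split; apply: eq_bigr => k _ /=; ring.
apply: (eq_lincomb 1 e1); ring.
Qed.

(** Both sides satisfy (m+1) Q_(m+1) = -8(m+2) Q_m - 4 R_m and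
    (m+1) R_(m+1) + 4m R_m = Q_(m+1) + 8 Q_m, with R_0 = 1 and Q_0 = 0. The
    combination m L + 2 M of the convolutions is the one that corresponds to
    the weight k. *)
Lemma zsum_conv N m : (m < N)%N ->
  zsum N m = (-1) ^+ m * conv_cbin m /\
  zsumk N m = (-1) ^+ m * (m%:Z * conv_cbin m + 2 * conv_kcbin m).
Proof.
elim: m => [|m IH] mN.
  have zc0 k : zcoef 0 k.+1 = 0 by rewrite zcoef_lo.
  rewrite expr0 !mul1r mul0r add0r /conv_cbin /conv_kcbin /bconv !big_ord1 /=.
  case: N mN => // N _; rewrite /zsum /zsumk !big_ord_recl !big1 /=.
  - by rewrite /zcoef expr0 coef1 /cbin !bin0.
  - by move=> k _; rewrite zc0 !mulr0.
  - by move=> k _; rewrite zc0 !mulr0.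
have [hR hQ] := IH (ltnW mN).
have r := zsum_rec N m; have q := zsumk_rec mN.
have L := conv_cbinS m; have M := conv_kcbinS m.
have e2 : m.+2%:Z = m%:Z + 2 by lia.
have e1 : m.+1%:Z = m%:Z + 1 by lia.
have nz : m.+1%:Z != 0 :> int by [].
have Qn : zsumk N m.+1 =
    (-1) ^+ m.+1 * (m.+1%:Z * conv_cbin m.+1 + 2 * conv_kcbin m.+1).
  apply: (mulfI nz); rewrite q hR hQ.
  apply: (eq_lincomb ((-1) ^+ m) L).
  rewrite [(-1) ^+ m.+1]exprS M e1 e2; ring.
split=> //; apply: (mulfI nz).
apply: (eq_lincomb 1 r); rewrite Qn hR hQ.
rewrite [(-1) ^+ m.+1]exprS M e1; ring.
Qed.

(** * The congruence of polynomials modulo p^3 *)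

(** k and n - k are below p and their sum is not: p divides n! but neither k!
    nor (n-k)!. *)
Lemma prime_dvd_bin_carry p n k :
  prime p -> (k < p)%N -> (n - k < p)%N -> (p <= n)%N -> (p%:Z %| 'C(n, k)%:Z)%Z.
Proof.
move=> pp kp nkp pn; rewrite dvdzE !absz_nat.
have kn : (k <= n)%N by apply: ltnW; exact: leq_trans kp pn.
have fact_ndvd m : (m < p)%N -> ~~ (p %| m`!)%N.
  elim: m => [|m IH] mp; first by rewrite fact0 Euclid_dvd1.
  rewrite factS Euclid_dvdM // negb_or IH ?(ltnW mp) // andbT.
  by rewrite gtnNdvd.
have : (p %| 'C(n, k) * (k`! * (n - k)`!))%N.
  by rewrite bin_fact // dvdn_fact // prime_gt0.
rewrite !Euclid_dvdM // (negPf (fact_ndvd _ kp)) (negPf (fact_ndvd _ nkp)).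
by rewrite !orbF.
Qed.

Lemma prime_dvd_cbin p k :
  prime p -> (k < p)%N -> (p <= 2 * k)%N -> (p%:Z %| cbin k)%Z.
Proof.
by move=> pp kp pk; apply: prime_dvd_bin_carry; rewrite // mul2n -addnn addnK.
Qed.

(** One factor p comes from C(m,i); the other from the larger of i and m - i,
    whose double is at least p. *)
Lemma prime2_dvd_bin_cbin2 p m i :
  prime p -> (p <= m)%N -> (i < p)%N -> (m - i < p)%N ->
  (p%:Z ^+ 2 %| 'C(m, i)%:Z * cbin i * cbin (m - i)%N)%Z.
Proof.
move=> pp pm ip jp; have hC := prime_dvd_bin_carry pp ip jp pm.
rewrite expr2 -mulrA; apply: dvdz_mul => //.
have [le|lt] := leqP p (2 * i); first by apply: dvdz_mulr; exact: prime_dvd_cbin.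
by apply: dvdz_mull; apply: prime_dvd_cbin => //; lia.
Qed.

Lemma coef_sum_sqpol2 p (phi : nat -> int) m :
  (\sum_(n < p) ((-1) ^+ n * phi n) *: sqpol n ^+ 2)`_m =
  \sum_(i < m.+1) 'C(m, i)%:Z * cbin i * cbin (m - i)%N *
    \sum_(r < i.+1) 'C(i, r)%:Z * 'C(m - i + r, i)%:Z *
      \sum_(n < p) (-1) ^+ n * phi n * legc n (m - i + r).
Proof.
rewrite coef_sum.
under eq_bigr => n _ do rewrite coefZ expr2 coefM mulr_sumr.
rewrite exchange_big /=; apply: eq_bigr => i _.
under [in RHS]eq_bigr => r _ do rewrite mulr_sumr.
rewrite [in RHS]exchange_big /= mulr_sumr; apply: eq_bigr => n _.
rewrite !coef_sqpol.
have im : (i <= m)%N by rewrite -ltnS.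
have := legc_mul n i (m - i); rewrite subnKC // => h.
have -> : \sum_(r < i.+1) 'C(i, r)%:Z * 'C(m - i + r, i)%:Z *
      ((-1) ^+ n * phi n * legc n (m - i + r)) = (-1) ^+ n * phi n *
   \sum_(r < i.+1) 'C(i, r)%:Z * 'C(m - i + r, i)%:Z * legc n (m - i + r).
  by rewrite mulr_sumr; apply: eq_bigr => r _; ring.
apply: (eq_lincomb ((-1) ^+ n * phi n * cbin i * cbin (m - i)%N) h); ring.
Qed.

(** Rewrites the coefficient of the right-hand polynomial in the shape of
    [coef_sum_sqpol2], with p (-1)^s (u + 2vs) in the place of the alternating
    sums over n. *)
Lemma coef_target_conv p (u v : int) m : (m < p)%N ->
  p%:Z * \sum_(k < p) cbin k ^+ 2 * (zcoef m k * (u + v * (k + m)%N%:Z))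
  = \sum_(i < m.+1) 'C(m, i)%:Z * cbin i * cbin (m - i)%N *
      \sum_(r < i.+1) 'C(i, r)%:Z * 'C(m - i + r, i)%:Z *
       (p%:Z * (-1) ^+ (m - i + r) * (u + 2 * v * (m - i + r)%N%:Z)).
Proof.
move=> mp; have [hR hQ] := zsum_conv mp.
transitivity (p%:Z * ((u + v * m%:Z) * zsum p m + v * zsumk p m)).
  congr (_ * _); rewrite /zsum /zsumk !mulr_sumr -big_split.
  by apply: eq_bigr => k _ /=; rewrite PoszD; ring.
rewrite hR hQ.
transitivity (p%:Z * (-1) ^+ m
  * ((u + 2 * v * m%:Z) * conv_cbin m + 2 * v * conv_kcbin m)); first ring.
rewrite /conv_cbin /conv_kcbin /bconv !mulr_sumr -big_split mulr_sumr.
apply: eq_bigr => i _ /=; have im : (i <= m)%N by rewrite -ltnS.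
transitivity ('C(m, i)%:Z * cbin i * cbin (m - i)%N * (p%:Z * (-1) ^+ (m - i) *
   \sum_(r < i.+1) (-1) ^+ r * 'C(i, r)%:Z * 'C(m - i + r, i)%:Z
      * (u + 2 * v * (m - i + r)%N%:Z))).
  rewrite (alt_sum_bin_lin i (m - i) u (2 * v)).
  have -> : (-1) ^+ m = (-1) ^+ (m - i) * (-1) ^+ i :> int.
    by rewrite -exprD subnK.
  have -> : m%:Z = i%:Z + (m - i)%N%:Z by lia.
  ring.
congr (_ * _); rewrite mulr_sumr; apply: eq_bigr => r _.
rewrite exprD; ring.
Qed.

(** Covers both congruences: [phi n] is 2n+1 or its cube, and u, v, e describe
    the value of the alternating sums. *)
Lemma coef_sum_sqpol2_mod (p : nat) (u v e : int) (phi : nat -> int) :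
  prime p ->
  (forall s, \sum_(n < p) (-1) ^+ n * phi n * legc n s
     = p%:Z * altq p s * (u + 2 * v * s%:Z + e * p%:Z ^+ 2)) ->
  forall m, (p%:Z ^+ 3 %|
    (\sum_(n < p) ((-1) ^+ n * phi n) *: sqpol n ^+ 2)`_m
    - p%:Z * \sum_(k < p) cbin k ^+ 2 * (zcoef m k * (u + v * (k + m)%N%:Z)))%Z.
Proof.
move=> pp hphi m; rewrite coef_sum_sqpol2.
under eq_bigr => i _ do under eq_bigr => r _ do rewrite hphi.
have [mp|pm] := ltnP m p.
  rewrite (coef_target_conv _ _ mp).
  rewrite -sumrB; apply: rpred_sum => i _; rewrite -mulrBr; apply: dvdz_mull.
  rewrite -sumrB; apply: rpred_sum => r _; rewrite -mulrBr; apply: dvdz_mull.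
  have sp : (m - i + r < p)%N by have := ltn_ord i; have := ltn_ord r; lia.
  set s := (m - i + r)%N in sp *.
  have -> : p%:Z * altq p s * (u + 2 * v * s%:Z + e * p%:Z ^+ 2) -
    p%:Z * (-1) ^+ s * (u + 2 * v * s%:Z) =
    (p%:Z * (altq p s - (-1) ^+ s)) * (u + 2 * v * s%:Z)
    + p%:Z ^+ 3 * (altq p s * e).
    ring.
  apply: rpredD; last by apply: dvdz_mulr; exact: dvdzz.
  apply: dvdz_mulr; rewrite [p%:Z ^+ 3]exprS; apply: dvdz_mul; first exact: dvdzz.
  exact: altq_mod.
(* m >= p: both coefficients are divisible by p^3. *)
apply: rpredB; last first.
  rewrite [p%:Z ^+ 3]exprS; apply: dvdz_mul; first exact: dvdzz.
  apply: rpred_sum => k _.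
  have [km|mk] := ltnP (2 * k) m; first by rewrite zcoef_hi // mul0r mulr0 dvdz0.
  apply: dvdz_mulr; apply: dvdz_exp2r; apply: prime_dvd_cbin => //.
  exact: leq_trans pm mk.
apply: rpred_sum => i _.
(* When i or m - i is at least p, every r contributes 0: either C(m-i+r,i)
   vanishes or m-i+r >= p and C(p-1,m-i+r) does. *)
have [ip|pi] := ltnP i p; last first.
  rewrite big1 ?mulr0 ?dvdz0 // => r _.
  have [si|is_] := ltnP (m - i + r) i.
    by rewrite [binomial _ i]bin_small // mulr0 mul0r.
  rewrite /altq [binomial p.-1 _]bin_small ?mul0r ?mulr0 ?mul0r ?mulr0 //.
  by have := prime_gt0 pp; lia.
have [jp|pj] := ltnP (m - i) p; last first.
  rewrite big1 ?mulr0 ?dvdz0 // => r _.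
  rewrite /altq [binomial p.-1 _]bin_small ?mul0r ?mulr0 ?mul0r ?mulr0 //.
  by have := prime_gt0 pp; lia.
rewrite [p%:Z ^+ 3]exprSr; apply: dvdz_mul; first exact: prime2_dvd_bin_cbin2.
apply: rpred_sum => r _; apply: dvdz_mull; rewrite -mulrA; apply: dvdz_mulr.
exact: dvdzz.
Qed.

(** * Evaluation at c/d *)

(** If p divided the reduced denominator of x / d^N, it would divide the
    numerator as well, as it is prime to d. *)
Lemma Zloc_frac (p : nat) (x d : int) N :
  prime p -> ~~ (p%:Z %| d)%Z -> x%:~R / d%:~R ^+ N \in Zloc p.
Proof.
move=> pp pd; have d0 : d != 0 by apply: contraNneq pd => ->; rewrite dvdz0.
rewrite /Zloc inE; set r := _ / _; apply/negP => pq.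
have e : numq r * d ^+ N = x * denq r.
  apply: (@intr_inj rat); rewrite !rmorphM rmorphXn /= numqE /r.
  by rewrite mulrAC divfK // expf_neq0 // intr_eq0.
have cpd : coprimez p%:Z (d ^+ N).
  by apply: coprimezXr; rewrite coprimezE absz_nat prime_coprime.
have : (p%:Z %| numq r * d ^+ N)%Z by rewrite e dvdz_mull.
rewrite Gauss_dvdzl // => pn.
have := coprime_num_den r; rewrite /coprime => /eqP g1.
have : (p %| gcdn `|numq r| `|denq r|)%N.
  by rewrite dvdn_gcd; move: pn pq; rewrite !dvdzE !absz_nat => -> ->.
by rewrite g1 Euclid_dvd1.
Qed.

Definition evq (t : rat) (P : {poly int}) : rat := (map_poly intr P).[t].

Section Evq.
Variable t : rat.
Lemma evqD P Q : evq t (P + Q) = evq t P + evq t Q.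
Proof. by rewrite /evq rmorphD hornerD. Qed.
Lemma evqN P : evq t (- P) = - evq t P.
Proof. by rewrite /evq rmorphN hornerN. Qed.
Lemma evqM P Q : evq t (P * Q) = evq t P * evq t Q.
Proof. by rewrite /evq rmorphM hornerM. Qed.
Lemma evqXn P n : evq t (P ^+ n) = evq t P ^+ n.
Proof. by rewrite /evq rmorphXn horner_exp. Qed.
Lemma evqC a : evq t a%:P = a%:~R.
Proof. by rewrite /evq map_polyC hornerC. Qed.
Lemma evqZ a P : evq t (a *: P) = a%:~R * evq t P.
Proof. by rewrite -mul_polyC evqM evqC. Qed.
Lemma evq1 : evq t 1 = 1.
Proof. by rewrite -[1]/(1%:P) evqC. Qed.
Lemma evqX : evq t 'X = t.
Proof. by rewrite /evq map_polyX hornerX. Qed.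
Lemma evq_sum n (F : 'I_n -> {poly int}) :
  evq t (\sum_(i < n) F i) = \sum_(i < n) evq t (F i).
Proof. by rewrite /evq rmorph_sum horner_sum. Qed.
Lemma evqMn P n : evq t (P *+ n) = evq t P *+ n.
Proof. by rewrite /evq rmorphMn hornerMn. Qed.
Definition evqE := (evqD, evqN, evqM, evqMn, evqXn, evqC, evqZ, evq1, evqX).
End Evq.

Lemma eqmodp_evq (p m : nat) (c d : int) (P Q : {poly int}) :
  prime p -> ~~ (p%:Z %| d)%Z ->
  (forall i, (p%:Z ^+ m %| P`_i - Q`_i)%Z) ->
  eqmodp p m (evq (c%:~R / d%:~R) P) (evq (c%:~R / d%:~R) Q).
Proof.
move=> pp pd h; set t := _ / _.
have d0 : d%:~R != 0 :> rat.
  by rewrite intr_eq0; apply: contraNneq pd => ->; rewrite dvdz0.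
(* Clear denominators: E collects the quotients of the coefficients by p^m. *)
pose N := size (P - Q); pose E i := ((P - Q)`_i %/ p%:Z ^+ m)%Z.
exists ((\sum_(i < N) E i * (c ^+ i * d ^+ (N - i)))%:~R / d%:~R ^+ N).
  exact: Zloc_frac.
rewrite -evqN -evqD /evq horner_coef size_map_inj_poly //; last first.
  by move=> x y /eqP; rewrite eqr_int => /eqP.
rewrite -/N rmorph_sum /= mulr_suml mulr_sumr; apply: eq_bigr => i _.
have -> : (map_poly intr (P - Q))`_i = p%:R ^+ m * (E i)%:~R :> rat.
  rewrite coef_map /= -[in LHS](divzK (_ : p%:Z ^+ m %| (P - Q)`_i)%Z) ?coefB //.
  by rewrite rmorphM rmorphXn mulrC /E coefB.
rewrite -mulrA; congr (_ * _).
rewrite !rmorphM !rmorphXn /= -mulrA; congr (_ * _).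
rewrite /t expr_div_n.
have -> : d%:~R ^+ N = d%:~R ^+ i * d%:~R ^+ (N - i) :> rat.
  by rewrite -exprD subnKC // ltnW.
by rewrite invfM mulrACA divff ?mulr1 // expf_neq0.
Qed.

Section Square.
Variables b c : int.
Let d : int := b ^+ 2 - 4 * c.
Hypothesis d0 : d != 0.
Let t : rat := c%:~R / d%:~R.
Let ev := evq t.
Let dq0 : d%:~R != 0 :> rat. Proof. by rewrite intr_eq0. Qed.

Lemma b2E : b%:~R ^+ 2 = d%:~R * (1 + 4 * t) :> rat.
Proof.
have -> : b%:~R ^+ 2 = d%:~R + 4 * c%:~R :> rat.
  by rewrite /d rmorphB rmorphXn rmorphM /= subrK.
by rewrite /t; field.
Qed.

Lemma ev_sqpol_rec n :
  n.+2%:R ^+ 2 * ev (sqpol n.+2) =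
  (1 + 4 * t) * ((2 * n + 3)%:R ^+ 2 * ev (sqpol n.+1)
    - 2 * (2 * n + 3)%:R * ev (crosspol n.+1)) + n.+1%:R ^+ 2 * ev (sqpol n).
Proof.
have := congr1 ev (sqpol_rec n); rewrite /ev.
by rewrite !evqE !(rmorphXn, rmorphM).
Qed.

Lemma ev_crosspol_rec n :
  ev (crosspol n.+1) + ev (crosspol n) = (2 * n + 1)%:R * ev (sqpol n).
Proof. by have := congr1 ev (crosspol_rec n); rewrite /ev !evqE. Qed.

(** Clausen's formula for the square, together with the companion formula for
    the products of consecutive terms. The latter carries a factor b on each
    side, so that only b^2 = d (1 + 4t) enters the computation. *)
Lemma trinom_sq_joint n :
  let T k : rat := (trinom b c k)%:~R in
  [/\ T n ^+ 2 = d%:~R ^+ n * ev (sqpol n),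
      T n.+1 ^+ 2 = d%:~R ^+ n.+1 * ev (sqpol n.+1)
    & n.+1%:R * b%:~R * T n.+1 * T n
      = d%:~R ^+ n * b%:~R ^+ 2 * ev (crosspol n.+1)].
Proof.
move=> T.
have A0 : ev (sqpol 0) = 1.
  rewrite (_ : sqpol 0 = 1) ?/ev ?evq1 //; apply/polyP => i.
  by rewrite coef_sqpol coef1; case: i.
have B0 : ev (crosspol 0) = 0.
  rewrite (_ : crosspol 0 = 0%:P) ?/ev ?evqC //; apply/polyP => i.
  by rewrite coef_crosspol coefC; case: i.
have A1 : ev (sqpol 1) = 1 + 4 * t.
  rewrite (_ : sqpol 1 = 1 + 4%:P * 'X) ?/ev ?evqE //; apply/polyP => i.
  by rewrite coef_sqpol coefD coef1 coefCM coefX; case: i => [|[|i]].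
have B1 : ev (crosspol 1) = 1.
  by have := ev_crosspol_rec 0; rewrite B0 A0 addr0 mulr1.
elim: n => [|n [IH0 IH1 IH2]].
  rewrite A0 A1 B1 /T trinom0 trinom1; split; [ring | rewrite b2E; ring | ring].
have rec : n.+2%:R * T n.+2 =
    (2 * n + 3)%:R * b%:~R * T n.+1 - n.+1%:R * d%:~R * T n.
  have := congr1 (fun x : int => x%:~R : rat) (trinom_rec b c n).
  by rewrite /T rmorphB !rmorphM.
have nz : n.+2%:R != 0 :> rat by rewrite pnatr_eq0.
split=> //.
- have nz2 : n.+2%:R ^+ 2 != 0 :> rat by rewrite expf_neq0.
  apply: (mulfI nz2); rewrite [RHS]mulrCA ev_sqpol_rec -exprMn rec.
  transitivity ((2 * n + 3)%:R ^+ 2 * b%:~R ^+ 2 * T n.+1 ^+ 2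
     - 2 * (2 * n + 3)%:R * d%:~R * (n.+1%:R * b%:~R * T n.+1 * T n)
     + n.+1%:R ^+ 2 * d%:~R ^+ 2 * T n ^+ 2); first ring.
  rewrite IH0 IH1 IH2 b2E !exprS; ring.
- transitivity (b%:~R * T n.+1 * (n.+2%:R * T n.+2)); first ring.
  rewrite rec.
  transitivity ((2 * n + 3)%:R * b%:~R ^+ 2 * T n.+1 ^+ 2
     - d%:~R * (n.+1%:R * b%:~R * T n.+1 * T n)); first ring.
  rewrite IH1 IH2.
  apply: (eq_lincomb (- d%:~R ^+ n.+1 * b%:~R ^+ 2) (ev_crosspol_rec n.+1)).
  rewrite (_ : (2 * n.+1 + 1 = 2 * n + 3)%N); last by lia.
  rewrite !exprS; ring.
Qed.

Lemma trinom_sq n :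
  (trinom b c n)%:~R ^+ 2 = d%:~R ^+ n * ev (sqpol n) :> rat.
Proof. by have [] := trinom_sq_joint n. Qed.

Lemma trinom_4 n :
  (trinom b c n)%:~R ^+ 4 / d%:~R ^+ (2 * n) = ev (sqpol n ^+ 2).
Proof.
rewrite /ev evqXn -[4%N]/(2 * 2)%N exprM trinom_sq exprMn -exprM [(n * 2)%N]mulnC.
by rewrite mulrC mulKf // expf_neq0.
Qed.

Lemma ev_zpol k :
  ev (zpol ^+ k) = (- c)%:~R ^+ k * b%:~R ^+ (2 * k) / d%:~R ^+ (2 * k).
Proof.
rewrite /ev evqXn /zpol !evqE exprM b2E.
rewrite (_ : - _ = (- c)%:~R * (d%:~R * (1 + 4 * t)) / d%:~R ^+ 2).
  by rewrite !exprMn exprVn -exprM.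
by rewrite /t rmorphN /=; field.
Qed.

(** Since X d/dX multiplies the coefficient of X^m by m, this is z^k with its
    coefficients multiplied by u + v(k+m). *)
Definition rhspol (u v : int) k : {poly int} :=
  (u + v * k%:Z) *: zpol ^+ k + v *: ('X * (zpol ^+ k)^`()).

Lemma coef_rhspol u v k m :
  (rhspol u v k)`_m = zcoef m k * (u + v * (k + m)%N%:Z).
Proof. rewrite coefD !coefZ coef_Xderiv /zcoef PoszD; ring. Qed.

Lemma ev_rhspol1 k :
  ev (rhspol 1 0 k) = (- c)%:~R ^+ k * b%:~R ^+ (2 * k) / d%:~R ^+ (2 * k).
Proof. by rewrite /rhspol mul0r addr0 scale1r scale0r addr0 ev_zpol. Qed.

(** For y = 1 + 4t and z = -ty, one has t dz/dt = -t(1+8t), so that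
    -3 z^k - 2 (k z^k + t d(z^k)/dt) = -(-t)^k ((3+4k) y^k + 8kt y^(k-1)). *)
Lemma ev_rhspol2 k :
  ev (rhspol (-3) (-2) k)
  = - ((- c)%:~R ^+ k * (weight b c k)%:~R / d%:~R ^+ (2 * k)).
Proof.
have -> : (weight b c k)%:~R = (3 + 4 * k%:R) * b%:~R ^+ (2 * k)
   + 8 * c%:~R * k%:R * b%:~R ^+ (2 * k.-1) :> rat.
  by rewrite /weight !(rmorphD, rmorphXn, rmorphM).
have -> : ev (rhspol (-3) (-2) k) = - (3 + 2 * k%:R) * ev (zpol ^+ k)
    + 2 * k%:R * t * (1 + 8 * t) * ev (zpol ^+ k.-1).
  rewrite /rhspol deriv_exp deriv_zpol /ev !evqE.
  rewrite !(rmorphD, rmorphM, rmorphN) /=; ring.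
rewrite !ev_zpol.
case: k => [|k]; first by rewrite /= !expr0; field.
rewrite /= (_ : (2 * k.+1 = 2 + 2 * k)%N); last by lia.
rewrite !exprD exprS !rmorphN /= !b2E /t.
by field; rewrite !expf_neq0.
Qed.

End Square.

(** * The two congruences *)

Lemma eqmodp_sum_trinom (p : nat) (b c u v e : int) (phi : nat -> int)
    (lhs rhs : nat -> rat) :
  let d : int := b ^+ 2 - 4 * c in
  prime p -> ~~ (p%:Z %| d)%Z ->
  (forall s, \sum_(n < p) (-1) ^+ n * phi n * legc n s
     = p%:Z * altq p s * (u + 2 * v * s%:Z + e * p%:Z ^+ 2)) ->
  (forall n, lhs n = (-1) ^+ n * (phi n)%:~R
                     * ((trinom b c n)%:~R ^+ 4 / d%:~R ^+ (2 * n))) ->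
  (forall k, rhs k = 'C(2 * k, k)%:R ^+ 2 * evq (c%:~R / d%:~R) (rhspol u v k)) ->
  eqmodp p 3 (\sum_(0 <= n < p) lhs n) (p%:R * \sum_(0 <= k < p) rhs k).
Proof.
move=> d pp pd hphi hl hr.
have d0 : d != 0 by apply: contraNneq pd => ->; rewrite dvdz0.
set t := c%:~R / d%:~R in hr.
have -> : \sum_(0 <= n < p) lhs n =
    evq t (\sum_(n < p) ((-1) ^+ n * phi n) *: sqpol n ^+ 2).
  rewrite big_mkord evq_sum; apply: eq_bigr => n _.
  by rewrite evqZ -trinom_4 // rmorphM rmorph_sign hl.
have -> : p%:R * \sum_(0 <= k < p) rhs k =
    evq t (p%:Z *: \sum_(k < p) cbin k ^+ 2 *: rhspol u v k).
  rewrite big_mkord evqZ evq_sum; congr (_ * _); apply: eq_bigr => k _.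
  by rewrite evqZ rmorphXn hr.
apply: eqmodp_evq => // m; rewrite coefZ [X in _ - _ * X]coef_sum.
under [X in _ - _ * X]eq_bigr => k _ do rewrite coefZ coef_rhspol.
exact: coef_sum_sqpol2_mod pp hphi m.
Qed.

Theorem theorem3 (p : nat) (b c : int) (p_pr : prime p) (p_ge5 : (5 <= p)%N) :
  let d : int := b ^+ 2 - 4 * c in
  ~~ (p%:Z %| d)%Z ->
  eqmodp p 3
    (\sum_(0 <= k < p)
       (2 * k + 1)%:R * (-1) ^+ k * (trinom b c k)%:~R ^+ 4 / d%:~R ^+ (2 * k))
    (p%:R * \sum_(0 <= k < p)
       ('C(2 * k, k))%:R ^+ 2 * ((- c)%:~R ^+ k * b%:~R ^+ (2 * k))
         / d%:~R ^+ (2 * k))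
  /\
  eqmodp p 3
    (\sum_(0 <= k < p)
       (2 * k + 1)%:R ^+ 3 * (-1) ^+ k * (trinom b c k)%:~R ^+ 4
         / d%:~R ^+ (2 * k))
    (- (p%:R * \sum_(0 <= k < p)
       ('C(2 * k, k))%:R ^+ 2 * ((- c)%:~R ^+ k * (weight b c k)%:~R)
         / d%:~R ^+ (2 * k))).
Proof.
move=> d pd.
have d0 : d != 0 by apply: contraNneq pd => ->; rewrite dvdz0.
have odd_p : odd p by case: (even_prime p_pr) p_ge5 => // ->.
have sgn : (-1) ^+ p = -1 :> int by rewrite -signr_odd odd_p.
have gE s : (s%:Z - p%:Z) * legc p s = - (p%:Z * altq p s).
  by rewrite -altqE ?prime_gt0 // -mulNr opprB.
split.
- apply: (@eqmodp_sum_trinom p b c 1 0 0 (fun n => (2 * n + 1)%N%:Z)) => // k.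
  + by rewrite sum_legc sgn -mulrA gE; ring.
  + by rewrite [RHS]mulrA [_ * _%:~R in RHS]mulrC.
  + by rewrite ev_rhspol1 // [RHS]mulrA.
- rewrite -mulrN -sumrN.
  apply: (@eqmodp_sum_trinom p b c (-3) (-2) 4
    (fun n => (2 * n + 1)%N%:Z ^+ 3)) => // k.
  + by rewrite sum_legc_cube sgn -[-1 * _ * _]mulrA gE; ring.
  + by rewrite [RHS]mulrA [_ * _%:~R in RHS]mulrC rmorphXn.
  + by rewrite ev_rhspol2 // mulrN [in RHS]mulrA.
Qed.
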